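(* Thompson's group $V$ is $C^\ast$-simple.
   Context: Let $\mathcal{C}=\{0,1\}^{\mathbb{N}}$ be the binary Cantor set with the product topology; for a finite word $w$ in $\{0,1\}$, $C_w\subset\mathcal{C}$ is the cylinder of sequences having $w$ as initial prefix. Thompson's group $V$ is the group of homeomorphisms $g$ of $\mathcal{C}$ for which there exist two cylinder partitions $\{C_{w_1},\dots,C_{w_n}\}$ and $\{C_{z_1},\dots,C_{z_n}\}$ of $\mathcal{C}$ such that $g(w_ix)=z_ix$ for every $i$ and every binary sequence $x$. A group is $C^\ast$-simple if its reduced $C^\ast$-algebra is simple. *)

(* Defs.v *)
From HB Require Import structures.
From mathcomp Require Import all_boot all_order all_algebra.
From mathcomp Require Import complex ring.
From mathcomp Require Import all_classical all_reals all_analysis.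

Set Implicit Arguments.
Unset Strict Implicit.
Unset Printing Implicit Defensive.

Import Order.TTheory GRing.Theory Num.Theory.
Import numFieldNormedType.Exports.
Local Open Scope classical_set_scope.

(* The sequence [w x]. *)
Definition catw (w : seq bool) (x : cantor_space) : cantor_space :=
  fun n => if (n < size w)%N then nth false w n else x (n - size w)%N.

Definition cylinder (w : seq bool) : set cantor_space :=
  [set x | mkseq x (size w) = w].

Definition cylinder_partition n (w : 'I_n -> seq bool) : Prop :=
  partition [set: 'I_n] (fun i => cylinder (w i)) [set: cantor_space].

Definition homeomorphism (T U : topologicalType) (g : T -> U) : Prop :=
  exists h : U -> T, [/\ cancel g h, cancel h g, continuous g & continuous h].

Definition in_thompsonV (g : cantor_space -> cantor_space) : Prop :=
  homeomorphism g /\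
  exists n (w z : 'I_n -> seq bool),
    [/\ cylinder_partition w, cylinder_partition z &
        forall i x, g (catw (w i) x) = catw (z i) x].

Section thompsonV_closed.

Lemma cylinderP w x : cylinder w x <-> exists y, x = catw w y.
Proof.
rewrite /cylinder /=; split=> [e|[y ->]].
  exists (fun n => x (n + size w)%N); apply/funext => n; rewrite /catw.
  case: ltnP => h; last by rewrite subnK.
  by rewrite -[X in nth _ X]e nth_mkseq.
apply: (@eq_from_nth _ false); rewrite size_mkseq // => i iw.
by rewrite nth_mkseq // /catw iw.
Qed.

Lemma catw_cat w s x : catw (w ++ s) x = catw w (catw s x).
Proof.
apply/funext => n; rewrite /catw size_cat nth_cat.
case: (ltnP n (size w)) => h; first by rewrite ltn_addr.
by rewrite ltn_subLR // subnDA.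
Qed.

Lemma catwI w : injective (catw w).
Proof.
move=> x y e; apply/funext => n.
have := congr1 (fun f : cantor_space => f (size w + n)%N) e.
by rewrite /catw ltnNge leq_addr /= addKn.
Qed.

Lemma cylinder_cat w s x : cylinder (w ++ s) (catw w x) <-> cylinder s x.
Proof.
split=> /cylinderP[y]; rewrite ?catw_cat.
  by move=> /catwI ->; apply/cylinderP; exists y.
by move=> ->; apply/cylinderP; exists y; rewrite catw_cat.
Qed.

Lemma cylinder_common u z x : cylinder u x -> cylinder z x ->
  prefix u z || prefix z u.
Proof.
rewrite /cylinder /=.
wlog h : u z / (size u <= size z)%N => [W eu ez|eu ez].
  by case/orP: (leq_total (size u) (size z)) => h; [|rewrite orbC]; exact: W.
apply/orP; left; apply/prefixP; exists (drop (size u) z).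
rewrite -[LHS](cat_take_drop (size u)); congr (_ ++ _).
by rewrite -[RHS]eu -[X in take _ X]ez -map_take take_iota (minn_idPl h).
Qed.

Lemma cylinder_partitionP n (w : 'I_n -> seq bool) :
  cylinder_partition w <->
  (forall x, exists i, cylinder (w i) x) /\
  (forall x i j, cylinder (w i) x -> cylinder (w j) x -> i = j).
Proof.
split=> [[cov tI _]|[cov tI]].
  split=> [x|x i j wi wj].
    by have : setT x by []; rewrite -cov => -[i _ wi]; exists i.
  by apply: tI => //; exists x.
split; first by apply/seteqP; split=> x // _; case: (cov x) => i; exists i.
  by move=> i j _ _ [x [wi wj]]; exact: tI wi wj.
move=> i _.
by exists (catw (w i) point); apply/cylinderP; exists point.
Qed.

Lemma homeomorphism_comp (T U W : topologicalType) (g : U -> W) (h : T -> U) :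
  homeomorphism g -> homeomorphism h -> homeomorphism (g \o h).
Proof.
move=> [g' [gK gK' cg cg']] [h' [hK hK' ch ch']]; exists (h' \o g'); split.
- exact: can_comp gK hK.
- exact: can_comp hK' gK'.
- by move=> x; apply: continuous_comp; [exact: ch|exact: cg].
- by move=> x; apply: continuous_comp; [exact: cg'|exact: ch'].
Qed.

(* [w ++ drop (size z) u] refines the cylinder of [w] by the part that the
   prefix exchange [w x |-> z x] sends into the cylinder of [u]. *)
Lemma cylinder_refine (h : cantor_space -> cantor_space) w z u x :
  (forall y, h (catw w y) = catw z y) -> prefix u z || prefix z u ->
  cylinder (w ++ drop (size z) u) x <-> cylinder w x /\ cylinder u (h x).
Proof.
move=> hwz cmp.
have main y : cylinder (w ++ drop (size z) u) (catw w y) <->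
    cylinder u (h (catw w y)).
  rewrite hwz cylinder_cat; case/orP: cmp => /prefixP[s e]; rewrite {}e.
    rewrite size_cat drop_oversize ?leq_addr // catw_cat; split=> _.
      by apply/cylinderP; eexists.
    by apply/cylinderP; exists y; apply/funext => n; rewrite /catw /= subn0.
  by rewrite drop_size_cat // cylinder_cat.
split=> [wx|[/cylinderP[y ->]]]; last by move/main.
have [y e] : exists y, x = catw w y.
  by case/cylinderP: wx => y ->; rewrite catw_cat; eexists.
by subst x; split; [apply/cylinderP; exists y|exact/main].
Qed.

Lemma in_thompsonV_comp g h :
  in_thompsonV g -> in_thompsonV h -> in_thompsonV (g \o h).
Proof.
move=> [Hg [m [u [v [/cylinder_partitionP[ucov uI]
  /cylinder_partitionP[vcov vI] guv]]]]].
move=> [Hh [n [w [z [/cylinder_partitionP[wcov wI]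
  /cylinder_partitionP[zcov zI] hwz]]]]].
split; first exact: homeomorphism_comp.
have [g' [gK gK' _ _]] := Hg; have [h' [hK hK' _ _]] := Hh.
have g'vu j y : g' (catw (v j) y) = catw (u j) y by rewrite -guv gK.
pose A := [set p : 'I_n * 'I_m | prefix (u p.2) (z p.1) || prefix (z p.1) (u p.2)]%SET.
have AP p : p \in A -> prefix (u p.2) (z p.1) || prefix (z p.1) (u p.2).
  by rewrite inE.
pose a (k : 'I_#|A|) := enum_val k.
have aA k : a k \in A by exact: enum_valP.
have hz i x : cylinder (w i) x -> cylinder (z i) (h x).
  by case/cylinderP => y ->; rewrite hwz; apply/cylinderP; eexists.
have g'u j y : cylinder (v j) y -> cylinder (u j) (g' y).
  by case/cylinderP => x ->; rewrite g'vu; apply/cylinderP; eexists.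
have cmp i j x : cylinder (z i) x -> cylinder (u j) x -> (i, j) \in A.
  by move=> zx ux; rewrite inE /=; exact: cylinder_common ux zx.
have dom k x := cylinder_refine x (hwz (a k).1) (AP _ (aA k)).
have cod k y : cylinder (v (a k).2 ++ drop (size (u (a k).2)) (z (a k).1)) y <->
    cylinder (v (a k).2) y /\ cylinder (z (a k).1) (g' y).
  by apply: (cylinder_refine y (g'vu _)); rewrite orbC; exact: AP (aA k).
exists #|A|, (fun k => w (a k).1 ++ drop (size (z (a k).1)) (u (a k).2)),
  (fun k => v (a k).2 ++ drop (size (u (a k).2)) (z (a k).1)); split.
- apply/cylinder_partitionP; split=> [x|x k l /dom[wk uk] /dom[wl ul]].
    have [i wi] := wcov x; have [j uj] := ucov (h x).
    have ijA := cmp _ _ _ (hz _ _ wi) uj.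
    by exists (enum_rank_in ijA (i, j)); apply/dom; rewrite /a enum_rankK_in.
  apply: enum_val_inj; rewrite -/(a k) -/(a l) (surjective_pairing (a k)).
  by rewrite (surjective_pairing (a l)) (wI _ _ _ wk wl) (uI _ _ _ uk ul).
- apply/cylinder_partitionP; split=> [y|y k l /cod[vk zk] /cod[vl zl]].
    have [j vj] := vcov y; have [i zi] := zcov (g' y).
    have ijA := cmp _ _ _ zi (g'u _ _ vj).
    by exists (enum_rank_in ijA (i, j)); apply/cod; rewrite /a enum_rankK_in.
  apply: enum_val_inj; rewrite -/(a k) -/(a l) (surjective_pairing (a k)).
  by rewrite (surjective_pairing (a l)) (vI _ _ _ vk vl) (zI _ _ _ zk zl).
- move=> k x; rewrite /= !catw_cat hwz.
  have e : catw (z (a k).1) (catw (drop (size (z (a k).1)) (u (a k).2)) x) =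
           catw (u (a k).2) (catw (drop (size (u (a k).2)) (z (a k).1)) x).
    rewrite -!catw_cat; congr catw.
    case/orP: (AP _ (aA k)) => /prefixP[s ->];
      by rewrite drop_size_cat // drop_oversize ?cats0 // size_cat leq_addr.
  by rewrite e guv.
Qed.

Lemma in_thompsonV_id : in_thompsonV idfun.
Proof.
split; first by exists idfun; split=> // x; exact: cvg_id.
have P : cylinder_partition (fun _ : 'I_1 => [::]).
  apply/cylinder_partitionP; split=> [x|x i j _ _]; first by exists ord0.
  by rewrite !ord1.
by exists 1%N, (fun=> [::]), (fun=> [::]); split.
Qed.

Lemma in_thompsonV_inv g : in_thompsonV g ->
  exists h, [/\ cancel g h, cancel h g & in_thompsonV h].
Proof.
move=> [[h [gK hK cg ch]] [n [w [z [Pw Pz gwz]]]]]; exists h; split=> //.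
split; first by exists g.
by exists n, z, w; split=> // i x; rewrite -gwz gK.
Qed.

End thompsonV_closed.

Record thompsonV := ThompsonV {
  thompsonV_fun :> cantor_space -> cantor_space ;
  thompsonV_subproof : `[< in_thompsonV thompsonV_fun >] }.

HB.instance Definition _ := [isSub for thompsonV_fun].
HB.instance Definition _ := [Choice of thompsonV by <:].

Lemma thompsonVP (g : thompsonV) : in_thompsonV g.
Proof. exact/asboolP/thompsonV_subproof. Qed.

Definition thompsonV_one : thompsonV := ThompsonV (asboolT in_thompsonV_id).

(* Composition, [h] being applied first. *)
Definition thompsonV_mul (g h : thompsonV) : thompsonV :=
  ThompsonV (asboolT (in_thompsonV_comp (thompsonVP g) (thompsonVP h))).

Definition thompsonV_inv (g : thompsonV) : thompsonV :=
  let: exist _ (And3 _ _ H) := cid (in_thompsonV_inv (thompsonVP g)) in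
  ThompsonV (asboolT H).

Lemma thompsonV_funK (g : thompsonV) : cancel g (thompsonV_inv g).
Proof. by rewrite /thompsonV_inv; case: cid => h [? ? ?]. Qed.

Lemma thompsonV_invK (g : thompsonV) : cancel (thompsonV_inv g) g.
Proof. by rewrite /thompsonV_inv; case: cid => h [? ? ?]. Qed.

Lemma thompsonV_mulA : associative thompsonV_mul.
Proof. by move=> f g h; apply: val_inj. Qed.
Lemma thompsonV_mul1 : left_id thompsonV_one thompsonV_mul.
Proof. by move=> g; apply: val_inj. Qed.
Lemma thompsonV_mulr1 : right_id thompsonV_one thompsonV_mul.
Proof. by move=> g; apply: val_inj. Qed.
Lemma thompsonV_mulV : left_inverse thompsonV_one thompsonV_inv thompsonV_mul.
Proof. by move=> g; apply/val_inj/funext => x; exact: thompsonV_funK. Qed.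
Lemma thompsonV_mulrV : right_inverse thompsonV_one thompsonV_inv thompsonV_mul.
Proof. by move=> g; apply/val_inj/funext => x; exact: thompsonV_invK. Qed.

HB.instance Definition _ := isGroup.Build thompsonV
  thompsonV_mulA thompsonV_mul1 thompsonV_mulr1 thompsonV_mulV thompsonV_mulrV.

Local Open Scope ring_scope.
Local Open Scope complex_scope.

Local Notation normc := ComplexField.Normc.normc.

(* Norms of a normed module over R[i] are elements of R[i]; [rnorm] is the
   same norm read in R. *)
Definition rnorm (R : realType) (V : normedModType R[i]) (x : V) : R :=
  complex.Re `|x|.

Lemma normc_ge0 (R : realType) (a : R[i]) : 0 <= normc a.
Proof. by case: a => u v; rewrite sqrtr_ge0. Qed.

Section rnorm_theory.
Variables (R : realType) (V : normedModType R[i]).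
Implicit Types x y : V.

Lemma rnormE x : `|x| = (rnorm x)%:C.
Proof. by rewrite /rnorm RRe_real // realE normr_ge0. Qed.

Lemma rnorm_ge0 x : 0 <= rnorm x.
Proof. by rewrite -ler0c -rnormE. Qed.

Lemma rnormD x y : rnorm (x + y) <= rnorm x + rnorm y.
Proof.
have := @ler_normD _ V x y; rewrite !rnormE -rmorphD lecR.
by [].
Qed.

Lemma rnormZ (a : R[i]) x : rnorm (a *: x) = normc a * rnorm x.
Proof.
apply: (@complexI R); have := @normrZ _ V a x; rewrite !rnormE => ->.
by rewrite rmorphM.
Qed.

Lemma rnorm0 : rnorm (0 : V) = 0.
Proof. by rewrite /rnorm normr0. Qed.

Lemma rnorm_eq0 x : rnorm x = 0 -> x = 0.
Proof. by move=> e; apply/normr0_eq0; rewrite rnormE e. Qed.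

End rnorm_theory.

Section bounded_operators.
Variables (R : realType) (V : normedModType R[i]).

Definition bounded_op (f : V -> V) : Prop :=
  linear f /\ exists M : R, forall x, rnorm (f x) <= M * rnorm x.

Definition bop_pred : {pred V -> V} := fun f => `[< bounded_op f >].

Record bop := Bop { bop_fun :> V -> V ; bop_subproof : bop_pred bop_fun }.

HB.instance Definition _ := [isSub for bop_fun].
HB.instance Definition _ := [Choice of bop by <:].

Lemma bopP (f : bop) : bounded_op f.
Proof. exact/asboolP/bop_subproof. Qed.

Lemma bounded_op_submod_closed : GRing.submod_closed bop_pred.
Proof.
split=> [|a f g /asboolP[lf [M fM]] /asboolP[lg [N gN]]]; apply/asboolP.
  split; first by move=> b x y; rewrite /= scaler0 addr0.
  by exists 0 => x; rewrite mul0r rnorm0.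
split=> [b x y|].
  change (a *: f (b *: x + y) + g (b *: x + y) =
          b *: (a *: f x + g x) + (a *: f y + g y)).
  by rewrite lf lg !scalerDr !scalerA (mulrC a b) addrACA.
exists (normc a * M + N) => x.
rewrite (le_trans (rnormD _ _)) // mulrDl lerD // rnormZ -mulrA.
by rewrite ler_wpM2l // normc_ge0.
Qed.

HB.instance Definition _ := GRing.isSubmodClosed.Build _ _ bop_pred
  bounded_op_submod_closed.
HB.instance Definition _ := [SubChoice_isSubLmodule of bop by <:].

Lemma bounded_op_id : bounded_op idfun.
Proof. by split=> //; exists 1 => x; rewrite mul1r. Qed.

Lemma bounded_op_comp f g : bounded_op f -> bounded_op g -> bounded_op (f \o g).
Proof.
move=> [lf [M fM]] [lg [N gN]]; split=> [a x y|]; first by rewrite /= lg lf.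
exists (Num.max M 0 * N) => x /=; rewrite (le_trans (fM _)) // -mulrA.
rewrite (@le_trans _ _ (Num.max M 0 * rnorm (g x))) //.
  by rewrite ler_wpM2r ?rnorm_ge0 // le_max lexx.
by rewrite ler_wpM2l // le_max lexx orbT.
Qed.

Definition bop_one : bop := Bop (asboolT bounded_op_id).
Definition bop_mul (f g : bop) : bop :=
  Bop (asboolT (bounded_op_comp (bopP f) (bopP g))).

Fact bop_mulA : associative bop_mul.
Proof. by move=> f g h; apply: val_inj. Qed.
Fact bop_mul1 : left_id bop_one bop_mul.
Proof. by move=> f; apply: val_inj. Qed.
Fact bop_mulr1 : right_id bop_one bop_mul.
Proof. by move=> f; apply: val_inj. Qed.
Fact bop_mulDl : left_distributive bop_mul +%R.
Proof. by move=> f g h; apply: val_inj. Qed.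
Fact bop_mulDr : right_distributive bop_mul +%R.
Proof.
move=> f g h; apply/val_inj/funext => x.
by have := (bopP f).1 1 (g x) (h x); rewrite !scale1r.
Qed.

HB.instance Definition _ := GRing.Zmodule_isPzRing.Build bop
  bop_mulA bop_mul1 bop_mulr1 bop_mulDl bop_mulDr.

(* The operator norm, sup over the closed unit ball. *)
Definition opnorm (f : bop) : R :=
  sup [set rnorm (f x) | x in [set x | rnorm x <= 1]].

Lemma bop0 (f : bop) : f 0 = 0.
Proof. by have := (bopP f).1 (-1) 0 0; rewrite scaleN1r addr0 scaleN1r addNr oppr0. Qed.

Lemma bopZ (f : bop) a x : f (a *: x) = a *: f x.
Proof. by have := (bopP f).1 a x 0; rewrite !addr0 bop0 addr0. Qed.

Lemma opnorm_has_sup (f : bop) :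
  has_sup [set rnorm (f x) | x in [set x | rnorm x <= 1]].
Proof.
split; first by exists (rnorm (f 0)), 0 => //=; rewrite rnorm0 ler01.
have [_ [M fM]] := bopP f; exists (Num.max M 0) => _ [x /= x1 <-].
rewrite (le_trans (fM x)) // -[leRHS]mulr1.
rewrite (@le_trans _ _ (Num.max M 0 * rnorm x)) //.
  by rewrite ler_wpM2r ?rnorm_ge0 // le_max lexx.
by rewrite ler_wpM2l // le_max lexx orbT.
Qed.

Lemma opnorm_ub (f : bop) x : rnorm x <= 1 -> rnorm (f x) <= opnorm f.
Proof. by move=> x1; apply: (sup_upper_bound (opnorm_has_sup f)); exists x. Qed.

Lemma opnorm_le (f : bop) (M : R) :
  (forall x, rnorm x <= 1 -> rnorm (f x) <= M) -> opnorm f <= M.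
Proof.
move=> fM; apply: ge_sup; first by have [] := opnorm_has_sup f.
by move=> _ [x x1 <-]; exact: fM.
Qed.

Lemma opnorm_ge0 f : 0 <= opnorm f.
Proof. by rewrite -(@rnorm0 _ V) -(bop0 f) opnorm_ub // rnorm0 ler01. Qed.

Lemma opnorm_bound (f : bop) x : rnorm (f x) <= opnorm f * rnorm x.
Proof.
have [x0|x0] := eqVneq (rnorm x) 0.
  by rewrite (rnorm_eq0 x0) bop0 !rnorm0 mulr0.
have xp : 0 < rnorm x by rewrite lt_def x0 rnorm_ge0.
have nV : normc ((rnorm x)^-1)%:C = (rnorm x)^-1.
  by rewrite /= expr0n addr0 sqrtr_sqr ger0_norm // invr_ge0 ltW.
have := @opnorm_ub f (((rnorm x)^-1)%:C *: x).
rewrite bopZ !rnormZ nV mulVf // => /(_ (lexx _)).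
by rewrite ler_pdivrMl // mulrC.
Qed.

Fact opnormD (f g : bop) : (opnorm (f + g))%:C <= (opnorm f)%:C + (opnorm g)%:C.
Proof.
rewrite -rmorphD lecR; apply: opnorm_le => x x1.
by rewrite (le_trans (rnormD _ _)) // lerD // opnorm_ub.
Qed.

Fact opnormZ (a : R[i]) (f : bop) : (opnorm (a *: f))%:C = `|a| * (opnorm f)%:C.
Proof.
have n0 := @normc_ge0 R.
have le b (g : bop) : opnorm (b *: g) <= normc b * opnorm g.
  apply: opnorm_le => x x1; rewrite rnormZ ler_wpM2l //.
  exact: opnorm_ub.
have -> : `|a| = (normc a)%:C by [].
rewrite -rmorphM; congr (_%:C); apply/eqP; rewrite eq_le le /=.
have [->|a0] := eqVneq a 0.
  by rewrite ComplexField.Normc.normc0 mul0r opnorm_ge0.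
have np : 0 < normc a.
  rewrite lt_def n0 andbT; apply: contra a0.
  by move=> /eqP/ComplexField.Normc.eq0_normc ->.
have := le a^-1 (a *: f).
by rewrite scalerA mulVf // scale1r ComplexField.Normc.normcV ler_pdivlMl.
Qed.

Fact opnorm_eq0 (f : bop) : (opnorm f)%:C = 0 -> f = 0.
Proof.
move=> /complexI f0; apply/val_inj/funext => x; apply: rnorm_eq0.
apply/eqP; rewrite eq_le rnorm_ge0 andbT.
by rewrite (le_trans (opnorm_bound f x)) // f0 mul0r.
Qed.

HB.instance Definition _ := Lmodule_isNormed.Build R[i] bop
  opnormD opnormZ opnorm_eq0.

End bounded_operators.

Section l2.
Variables (R : realType) (I : choiceType).

Definition sqsum (f : I -> R[i]) : \bar R :=
  \esum_(i in [set: I]) (normc (f i) ^+ 2)%:E.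

Definition l2_pred : {pred I -> R[i]} := fun f => (sqsum f < +oo)%E.

Record l2 := L2 { l2_fun :> I -> R[i] ; l2_subproof : l2_pred l2_fun }.

HB.instance Definition _ := [isSub for l2_fun].
HB.instance Definition _ := [Choice of l2 by <:].

Lemma sqsum_ge0 f : (0 <= sqsum f)%E.
Proof. by apply: esum_ge0 => i _; rewrite lee_fin sqr_ge0. Qed.

Lemma le_esumZ (c : R) (a : I -> \bar R) : 0 <= c -> (forall i, 0 <= a i)%E ->
  (\esum_(i in [set: I]) (c%:E * a i) <= c%:E * \esum_(i in [set: I]) a i)%E.
Proof.
move=> c0 a0; apply: ge_ereal_sup => _ [X [finX _] <-].
rewrite -ge0_mule_fsumr //; apply: lee_wpmul2l; first by rewrite lee_fin.
by apply: ereal_sup_ubound; exists X.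
Qed.

Lemma le_sqsumZ (c : R[i]) f : (sqsum (c *: f) <= (normc c ^+ 2)%:E * sqsum f)%E.
Proof.
apply: le_trans (le_esumZ _ _); rewrite ?sqr_ge0 //; last first.
  by move=> i; rewrite lee_fin sqr_ge0.
apply: le_esum => i _; rewrite -EFinM lee_fin -exprMn.
by rewrite -ComplexField.Normc.normcM.
Qed.

Lemma le_sqsumD (t : R) (f g : I -> R[i]) : 0 < t ->
  (sqsum (f + g)%R <= (1 + t)%R%:E * sqsum f + (1 + t^-1)%R%:E * sqsum g)%E.
Proof.
move=> t0; have tV : 0 < t^-1 by rewrite invr_gt0.
have p (h : I -> R[i]) i : (0 <= (normc (h i) ^+ 2)%:E)%E.
  by rewrite lee_fin sqr_ge0.
have t1 : 0 <= 1 + t by rewrite addr_ge0 // ltW.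
have t2 : 0 <= 1 + t^-1 by rewrite addr_ge0 // ltW.
have le_fg := leeD (le_esumZ t1 (p f)) (le_esumZ t2 (p g)).
apply: (le_trans _ le_fg).
rewrite -esumD; [|by move=> i _; rewrite mule_ge0 // lee_fin addr_ge0 // ltW..].
apply: le_esum => i _; rewrite -!EFinM -EFinD lee_fin.
set a := _ (f i); set b := _ (g i).
have n0 := @normc_ge0 R.
have h : normc ((f + g) i) <= a + b.
  by rewrite -lecR rmorphD /=; exact: (@ler_normD _ R[i]).
have h2 : normc ((f + g) i) ^+ 2 <= (a + b) ^+ 2.
  by rewrite lerXn2r // ?nnegrE ?addr_ge0 // n0.
apply: le_trans h2 _.
have : 0 <= t^-1 * (t * a - b) ^+ 2 by rewrite mulr_ge0 ?sqr_ge0 // ltW.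
have -> : t^-1 * (t * a - b) ^+ 2 = t * a ^+ 2 - 2 * a * b + t^-1 * b ^+ 2.
  by field; rewrite lt0r_neq0.
by move=> H; rewrite -subr_ge0; apply: le_trans H _; rewrite le_eqVlt;
  apply/orP; left; apply/eqP; ring.
Qed.

Lemma l2_submod_closed : GRing.submod_closed l2_pred.
Proof.
split=> [|a f g lf lg].
  rewrite /in_mem /= /l2_pred /sqsum esum1 ?ltry // => i _.
  by rewrite ComplexField.Normc.normc0 expr0n.
have fin h : (sqsum h < +oo -> sqsum h = (fine (sqsum h))%:E)%E.
  by move=> ?; rewrite fineK // ge0_fin_numE // sqsum_ge0.
have laf : (sqsum (a *: f) < +oo)%E.
  by apply: le_lt_trans (le_sqsumZ _ _) _; rewrite (fin _ lf) -EFinM ltry.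
apply: le_lt_trans (le_sqsumD _ _ ltr01) _.
by rewrite (fin _ laf) (fin _ lg) -!EFinM -EFinD ltry.
Qed.

HB.instance Definition _ := GRing.isSubmodClosed.Build _ _ l2_pred
  l2_submod_closed.
HB.instance Definition _ := [SubChoice_isSubLmodule of l2 by <:].

Definition l2norm (f : l2) : R := Num.sqrt (fine (sqsum f)).

Lemma sqsumE (f : l2) : sqsum f = (l2norm f ^+ 2)%:E.
Proof.
rewrite sqr_sqrtr ?fine_ge0 ?sqsum_ge0 // fineK //.
by rewrite ge0_fin_numE ?sqsum_ge0 //; exact: l2_subproof.
Qed.

Lemma l2norm_ge0 f : 0 <= l2norm f.
Proof. exact: sqrtr_ge0. Qed.

Fact l2norm_eq0 (f : l2) : (l2norm f)%:C = 0 -> f = 0.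
Proof.
move=> /complexI f0; apply/val_inj/funext => i /=.
apply: ComplexField.Normc.eq0_normc; apply/eqP; rewrite -sqrf_eq0.
rewrite eq_le sqr_ge0 andbT -lee_fin.
have -> : 0%:E = sqsum f by rewrite sqsumE f0 expr0n.
apply: esum_ge; exists [set i]; last by rewrite fsbig_set1.
by split; [exact: finite_set1|].
Qed.

Fact l2normZ (a : R[i]) (f : l2) : (l2norm (a *: f))%:C = `|a| * (l2norm f)%:C.
Proof.
have n0 := @normc_ge0 R.
have le b (g : l2) : l2norm (b *: g) <= normc b * l2norm g.
  rewrite -(@ler_pXn2r _ 2) // ?nnegrE ?mulr_ge0 ?l2norm_ge0 ?n0 //.
  rewrite exprMn -lee_fin [leRHS]EFinM -(sqsumE (b *: g)) -(sqsumE g).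
  exact: le_sqsumZ.
have -> : `|a| = (normc a)%:C by [].
rewrite -rmorphM; congr (_%:C); apply/eqP; rewrite eq_le le /=.
have [->|a0] := eqVneq a 0.
  by rewrite ComplexField.Normc.normc0 mul0r l2norm_ge0.
have np : 0 < normc a.
  rewrite lt_def n0 andbT; apply: contra a0.
  by move=> /eqP/ComplexField.Normc.eq0_normc ->.
have := le a^-1 (a *: f).
by rewrite scalerA mulVf // scale1r ComplexField.Normc.normcV ler_pdivlMl.
Qed.

Fact l2normD (f g : l2) : (l2norm (f + g))%:C <= (l2norm f)%:C + (l2norm g)%:C.
Proof.
rewrite -rmorphD lecR.
have [/(congr1 (real_complex R))/l2norm_eq0 ->|f0] := eqVneq (l2norm f) 0.
  by rewrite add0r lerDr l2norm_ge0.
have [/(congr1 (real_complex R))/l2norm_eq0 ->|g0] := eqVneq (l2norm g) 0.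
  by rewrite addr0 lerDl l2norm_ge0.
have fp : 0 < l2norm f by rewrite lt_def f0 l2norm_ge0.
have gp : 0 < l2norm g by rewrite lt_def g0 l2norm_ge0.
rewrite -(@ler_pXn2r _ 2) // ?nnegrE ?addr_ge0 ?l2norm_ge0 //.
have := @le_sqsumD (l2norm g / l2norm f) (f : I -> R[i]) (g : I -> R[i]) (divr_gt0 gp fp).
rewrite -[sqsum (_ + _)]/(sqsum (f + g : l2)) !sqsumE -!EFinM -EFinD lee_fin.
by move/le_trans; apply; rewrite le_eqVlt; apply/orP; left; apply/eqP; field;
  rewrite f0 g0.
Qed.

HB.instance Definition _ := Lmodule_isNormed.Build R[i] l2
  l2normD l2normZ l2norm_eq0.

End l2.

Section reduced_Cstar_algebra.
Variables (R : realType) (G : groupType).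

Local Open Scope group_scope.

Definition ltrans (g : G) (f : G -> R[i]) : G -> R[i] := fun h => f (g^-1 * h).

Lemma sqsum_ltrans g f : sqsum (ltrans g f) = sqsum f.
Proof.
rewrite /sqsum /ltrans [RHS](reindex_esum [set: G] _ (fun h => g^-1 * h)) //.
split=> // [h k _ _ /mulgI//|h _]; exists (g * h) => //.
by rewrite mulKg.
Qed.

Definition lreg_fun (g : G) (f : l2 R G) : l2 R G :=
  L2 (eq_ind_r (fun x => (x < +oo)%E) (l2_subproof f) (sqsum_ltrans g f)).

Lemma bounded_op_lreg g : bounded_op (lreg_fun g).
Proof.
split=> [a x y|]; first exact: val_inj.
exists 1%R => x; rewrite mul1r /rnorm /Num.norm /= /l2norm /=.
by rewrite sqsum_ltrans.
Qed.

(* The left regular representation: [lreg g f h = f (g^-1 * h)]. *)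
Definition lreg (g : G) : bop (l2 R G) := Bop (asboolT (bounded_op_lreg g)).

Local Open Scope ring_scope.

(* The image in B(l2(G)) of the complex group algebra. *)
Definition lreg_span : set (bop (l2 R G)) :=
  [set T | exists s : seq (R[i] * G), T = \sum_(p <- s) p.1 *: lreg p.2].

(* The topology of [bop (l2 R G)] is that of the operator norm. *)
Definition reduced_Cstar_algebra : set (bop (l2 R G)) := closure lreg_span.

End reduced_Cstar_algebra.

Arguments reduced_Cstar_algebra : clear implicits.

Section simplicity.
Variables (R : realType) (V : normedModType R[i]).
Implicit Types A I : set (bop V).

(* [V] plays the role of a Hilbert space and [A] that of a closed subalgebra of
   its bounded operators; ideals are linear subspaces, and products of
   operators are compositions. *)
Record closed_two_sided_ideal A I : Prop := ClosedTwoSidedIdeal {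
  ideal_sub : I `<=` A ;
  ideal_0 : I 0 ;
  ideal_D : forall S T, I S -> I T -> I (S + T) ;
  ideal_Z : forall (c : R[i]) T, I T -> I (c *: T) ;
  ideal_Ml : forall S T, A S -> I T -> I (S * T) ;
  ideal_Mr : forall S T, A S -> I T -> I (T * S) ;
  ideal_closed : closed I }.

Definition simple_Cstar_algebra A : Prop :=
  forall I, closed_two_sided_ideal A I -> I = [set 0] \/ I = A.

End simplicity.

Definition Cstar_simple (R : realType) (G : groupType) : Prop :=
  simple_Cstar_algebra (reduced_Cstar_algebra R G).

(* Main.v *)
Require Import Defs.
From mathcomp Require Import all_boot all_order all_algebra.
From mathcomp Require Import complex ring lra.
From mathcomp Require Import all_classical all_reals all_analysis.

Set Implicit Arguments.
Unset Strict Implicit.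
Unset Printing Implicit Defensive.

Import Order.TTheory GRing.Theory Num.Theory.
Import numFieldNormedType.Exports.
Local Open Scope classical_set_scope.
Local Open Scope ring_scope.
Local Open Scope complex_scope.

Local Notation normc := ComplexField.Normc.normc.

(** The proof shows that V has a Powers averaging property: any finite set of
    nontrivial elements x admits elements h_1, ..., h_N, the same for all x,
    such that the average of the unitaries lambda(h_i x h_i^-1) has norm at
    most e. No freeness of the action on the Cantor set is available, since
    elements of V may fix open sets pointwise; what replaces it is that the
    elements of V supported in a small cylinder still contain many ping-pong
    players.

    Averaging implies simplicity ([powers_averaging_simple]). Write
    tau(T) = (T delta_1)(1). Averaging conjugates of an operator T of the
    algebra brings it close to the scalar tau(T), because this is true of finite
    combinations of the lambda(g) and averaging is a contraction. If T is a
    nonzero element of a closed ideal, then T delta_1 is nonzero, so some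
    translate lambda(g^-1) T has nonzero tau; its averages stay in the ideal and
    converge to a nonzero scalar, hence the ideal contains 1.

    The norm estimate ([pingpong_rnorm]) is that of Powers: if pairwise disjoint
    subsets D_i of a group G satisfy g_i (G \ D_i) <= D_i for i = 1, ..., N, then
    lambda(g_1) + ... + lambda(g_N) has norm at most 2 sqrt N.

    Averaging in V ([thompsonV_powers_averaging]). For nontrivial elements x of
    a finite set, choose points q_x such that x' (q_x) is never q_x'
    ([separated_points]); by continuity this persists for words w_x of some
    common length, that is, x' (C_(w_x)) misses C_(w_x')
    ([separated_prefixes]). Let h_i act inside every C_(w_x), in the coordinate
    y of w_x y, as the involution [slide] of a word v_i, which sends the
    complement of C_(v_i) into C_(v_i), and as the identity elsewhere. On C_(w_x)
    the element
    a_i = h_i x h_i^-1 x^-1 coincides with h_i, since x^-1 moves C_(w_x) off the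
    support of h_i. With the C_(v_i) pairwise disjoint, the a_i play ping-pong on
    C_(w_x), and the game is transported to V itself by following the image of
    one well-chosen point ([track]). So the sum of the lambda(a_i) has norm at
    most 2 sqrt N, and so has the sum of the
    lambda(h_i x h_i^-1) = lambda(a_i) lambda(x). *)

(** * Elementary inequalities for finite sums *)

Section finite_sums.
Variables (R : realFieldType) (I : finType).
Implicit Types a : I -> R.

(** Cauchy-Schwarz against the constant family 1, from 2 a_i a_j <= a_i^2 + a_j^2. *)
Lemma sqr_sum_le a : (\sum_i a i) ^+ 2 <= #|I|%:R * \sum_i a i ^+ 2.
Proof.
have e : #|I|%:R * (\sum_i a i ^+ 2) =
    \sum_i \sum_j (a i ^+ 2 + a j ^+ 2) / 2.
  transitivity (\sum_i ((#|I|%:R * a i ^+ 2 + \sum_j a j ^+ 2) / 2)).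
    rewrite -mulr_suml big_split /= -mulr_sumr sumr_const -[X in _ + X]mulr_natl.
    by field.
  apply: eq_bigr => i _; rewrite -[RHS]mulr_suml; congr (_ / 2).
  by rewrite big_split /= sumr_const mulr_natl.
rewrite e expr2 mulr_suml; apply: ler_sum => i _.
rewrite mulr_sumr; apply: ler_sum => j _.
rewrite ler_pdivlMr // -subr_ge0.
have -> : a i ^+ 2 + a j ^+ 2 - a i * a j * 2 = (a i - a j) ^+ 2 by ring.
exact: sqr_ge0.
Qed.

(** The pointwise form of Powers' estimate: the terms outside [d] number at most
    one, so they cost no factor [#|I|], and Cauchy-Schwarz is paid only on those
    inside [d], which will be small in total once summed over the group. *)
Lemma sqr_sum_le_split a (d : pred I) : (forall i, 0 <= a i) ->
  (forall i j, ~~ d i -> ~~ d j -> i = j) ->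
  (\sum_i a i) ^+ 2 <=
  2 * \sum_i a i ^+ 2 + 2 * #|I|%:R * \sum_(i | d i) a i ^+ 2.
Proof.
move=> a0 d1; rewrite (bigID d) /= big_mkcond /=.
set s := \sum_i _; set t := \sum_(i | _) _.
have s2 : s ^+ 2 <= #|I|%:R * \sum_(i | d i) a i ^+ 2.
  apply: le_trans (sqr_sum_le _) _; rewrite ler_wpM2l // [leRHS]big_mkcond.
  by apply: ler_sum => i _; case: ifP => // _; rewrite expr0n.
have t2 : t ^+ 2 <= \sum_i a i ^+ 2.
  rewrite /t; have [i /= di|d0] := pickP (fun i => ~~ d i).
    rewrite (big_pred1 i) => [|j]; last first.
      by apply/idP/eqP => [dj|->//]; exact: d1.
    by rewrite (bigD1 i) //= lerDl sumr_ge0 // => j _; exact: sqr_ge0.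
  rewrite big1 ?expr0n => [|i di]; last by have := d0 i; rewrite /= di.
  by rewrite sumr_ge0 // => j _; exact: sqr_ge0.
have := sqr_ge0 (s - t); nra.
Qed.

End finite_sums.

(** * Square-summable functions *)

Section l2_space.
Variables (R : realType) (I : choiceType).
Implicit Types f g : l2 R I.

Lemma l2_sumE (J : Type) (r : seq J) (F : J -> l2 R I) x :
  (\sum_(j <- r) F j) x = \sum_(j <- r) F j x.
Proof.
elim: r => [|j r IH]; first by rewrite !big_nil.
by rewrite !big_cons -IH.
Qed.

Lemma rnorm_sqsum f : (rnorm f ^+ 2)%:E = sqsum f.
Proof. by rewrite sqsumE. Qed.

Lemma normc_le_rnorm f x : normc (f x) <= rnorm f.
Proof.
rewrite -(@ler_pXn2r _ 2) ?nnegrE ?rnorm_ge0 ?normc_ge0 // -lee_fin.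
rewrite rnorm_sqsum; apply: esum_ge; exists [set x]; last by rewrite fsbig_set1.
by split; [exact: finite_set1|].
Qed.

End l2_space.

Lemma normc_sum (R : realType) (J : Type) (r : seq J) (F : J -> R[i]) :
  normc (\sum_(j <- r) F j) <= \sum_(j <- r) normc (F j).
Proof.
elim: r => [|j r IH]; first by rewrite !big_nil ComplexField.Normc.normc0.
rewrite !big_cons; apply: le_trans (_ : normc (F j) + normc (\sum_(k <- r) F k) <= _).
  by rewrite -lecR rmorphD /=; exact: (@ler_normD _ R[i]).
by rewrite lerD2l.
Qed.

Lemma bop_sumE (R : realType) (V : normedModType R[i]) (J : Type) (r : seq J)
  (F : J -> bop V) x : (\sum_(j <- r) F j) x = \sum_(j <- r) F j x.
Proof.
elim: r => [|j r IH]; first by rewrite !big_nil.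
by rewrite !big_cons -IH.
Qed.

(** * Norms of sums of ping-pong players *)

Section pingpong_norm.
Variables (R : realType) (G : groupType) (I : finType).
Variables (g : I -> G) (D : I -> set G).

Hypothesis Dtriv : forall i j x, D i x -> D j x -> i = j.
Hypothesis Dmap : forall i x, ~ D i x -> D i (g i * x)%g.

(** Fix h and consider the terms f (g_i^-1 h). If g_i^-1 h is not in D_i, then h
    is in D_i, which happens for at most one i. Summing
    [sqr_sum_le_split] over h, the first part gives 2 N |f|^2, and the second
    2 N times the sum over i of |f 1_(D_i)|^2, at most 2 N |f|^2 by
    disjointness. *)
Lemma pingpong_rnorm (f : l2 R G) :
  rnorm (\sum_i lreg R (g i) f) <= 2 * Num.sqrt #|I|%:R * rnorm f.
Proof.
pose n : R := #|I|%:R.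
pose a i h : R := normc (f ((g i)^-1 * h)%g) ^+ 2.
pose b i h : R := if `[< D i h >] then normc (f h) ^+ 2 else 0.
have a0 i h : 0 <= a i h by exact: sqr_ge0.
have b0 i h : 0 <= b i h by rewrite /b; case: ifP => // _; exact: sqr_ge0.
have n0 : 0 <= n by [].
rewrite -(@ler_pXn2r _ 2) ?nnegrE ?mulr_ge0 ?rnorm_ge0 ?sqrtr_ge0 //.
rewrite !exprMn (sqr_sqrtr n0) -lee_fin rnorm_sqsum.
pose A h := (\sum_i (a i h)%:E)%E.
pose B h := (\sum_i (b i ((g i)^-1 * h)%g)%:E)%E.
have A0 h : (0 <= A h)%E by apply: sume_ge0 => i _; rewrite lee_fin.
have B0 h : (0 <= B h)%E by apply: sume_ge0 => i _; rewrite lee_fin.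
have pw : (sqsum (\sum_i lreg R (g i) f)%R <=
    \esum_(h in [set: G]) (2%:E * A h + (2 * n)%:E * B h))%E.
  apply: le_esum => h _; rewrite l2_sumE /A /B !sumEFin -!EFinM -EFinD lee_fin.
  apply: le_trans (_ : (\sum_i normc (f ((g i)^-1 * h)%g)) ^+ 2 <= _).
    rewrite lerXn2r ?nnegrE ?normc_ge0 ?sumr_ge0 // => [i _|].
      exact: normc_ge0.
    exact: normc_sum.
  rewrite /b -big_mkcond; apply: sqr_sum_le_split => [i|i j].
    exact: normc_ge0.
  move=> /asboolP/Dmap Di /asboolP/Dmap Dj.
  by rewrite !mulVKg in Di Dj; exact: Dtriv Di Dj.
have tr (F : G -> \bar R) i : (\esum_(h in [set: G]) F ((g i)^-1 * h)%g =
    \esum_(h in [set: G]) F h)%E.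
  rewrite [RHS](reindex_esum [set: G] _ (fun h => ((g i)^-1 * h)%g)) //.
  split=> // [h k _ _ /mulgI//|h _]; exists (g i * h)%g => //.
  by rewrite mulKg.
have EA : (\esum_(h in [set: G]) A h = n%:E * (rnorm f ^+ 2)%:E)%E.
  rewrite /A esum_sum => [|h i _ _]; last by rewrite lee_fin.
  rewrite (eq_bigr (fun=> (rnorm f ^+ 2)%:E)) => [|i _].
    by rewrite sumEFin sumr_const -mulr_natl EFinM.
  by rewrite rnorm_sqsum /a (tr (fun h => (normc (f h) ^+ 2)%:E)).
have EB : (\esum_(h in [set: G]) B h <= (rnorm f ^+ 2)%:E)%E.
  rewrite /B esum_sum => [|h i _ _]; last by rewrite lee_fin.
  rewrite (eq_bigr (fun i => \esum_(h in [set: G]) (b i h)%:E)%E) => [|i _].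
    rewrite -esum_sum => [|h i _ _]; last by rewrite lee_fin.
    rewrite rnorm_sqsum; apply: le_esum => h _; rewrite sumEFin lee_fin.
    have [[i Di]|nD] := pselect (exists i, D i h).
      rewrite (bigD1 i) //= big1 ?addr0 => [|j ji].
        by rewrite /b asboolT.
      rewrite /b asboolF // => Dj; move/eqP: ji; apply.
      exact: Dtriv Dj Di.
    rewrite big1 ?sqr_ge0 // => i _.
    by rewrite /b asboolF // => Di; apply: nD; exists i.
  exact: (tr (fun h => (b i h)%:E)).
apply: le_trans pw _; rewrite esumD => [|h _|h _]; last 2 first.
  by rewrite mule_ge0 // lee_fin.
  by rewrite mule_ge0 // lee_fin mulr_ge0.
apply: le_trans (leeD (le_esumZ _ A0) (le_esumZ _ B0)) _ => //.
  by rewrite mulr_ge0.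
rewrite EA; apply: le_trans (leeD (lexx _) (lee_wpmul2l _ EB)) _.
  by rewrite lee_fin mulr_ge0.
by rewrite -!EFinM -EFinD lee_fin -/n; lra.
Qed.

End pingpong_norm.

(** * Bounded operators *)

Section bounded_operators.
Variables (R : realType) (V : normedModType R[i]).
Implicit Types (S T : bop V) (x : V).

Lemma rnormN x : rnorm (- x) = rnorm x.
Proof. by rewrite /rnorm normrN. Qed.

Lemma rnormB_le x y : rnorm (x - y) <= rnorm x + rnorm y.
Proof. by rewrite -[rnorm y]rnormN rnormD. Qed.

Lemma rnorm_sum (J : Type) (r : seq J) (F : J -> V) :
  rnorm (\sum_(j <- r) F j) <= \sum_(j <- r) rnorm (F j).
Proof.
elim: r => [|j r IH]; first by rewrite !big_nil rnorm0.
by rewrite !big_cons (le_trans (rnormD _ _)) // lerD2l.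
Qed.

Lemma closure_rnormP (A : set V) x :
  closure A x <-> forall e : R, 0 < e -> exists2 y, A y & rnorm (x - y) < e.
Proof.
split=> [cA e e0|H B /nbhs_ballP[e /= e0 eB]].
  have e0' : 0 < e%:C by rewrite (ltcR 0).
  have [y [Ay]] := cA _ (nbhsx_ballx x _ e0').
  by rewrite -ball_normE /= rnormE ltcR => ?; exists y.
have eR : e = (complex.Re e)%:C by rewrite RRe_real // gtr0_real.
have [|y Ay xy] := H (complex.Re e); first by rewrite -ltcR -eR.
exists y; split=> //; apply: eB.
by rewrite -ball_normE /= rnormE eR ltcR.
Qed.

Lemma bop_bound T x : rnorm (T x) <= rnorm T * rnorm x.
Proof. exact: opnorm_bound. Qed.

Lemma rnorm_bop_le T (M : R) : 0 <= M ->
  (forall x, rnorm (T x) <= M * rnorm x) -> rnorm T <= M.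
Proof.
move=> M0 TM; apply: opnorm_le => x x1; apply: le_trans (TM x) _.
by rewrite -[leRHS]mulr1 ler_wpM2l.
Qed.

Lemma bop_scalerAl (a : R[i]) S T : (a *: S) * T = a *: (S * T).
Proof. exact: val_inj. Qed.

Lemma bop_scalerAr (a : R[i]) S T : S * (a *: T) = a *: (S * T).
Proof. by apply/val_inj/funext => x; exact: bopZ. Qed.

End bounded_operators.

(** * Density of finitely supported functions *)

Section delta.
Variables (R : realType) (I : choiceType).

Definition delta_fun (i : I) : I -> R[i] := fun j => (j == i)%:R.

Lemma sqsum_delta i : sqsum (delta_fun i) = 1%E.
Proof.
rewrite /sqsum (esumID [set i]) => [|j _]; last by rewrite lee_fin sqr_ge0.
rewrite setTI esum_set1 ?lee_fin ?sqr_ge0 // setTI.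
rewrite [X in (_ + X)%E]esum1 => [|j /= /eqP ji]; last first.
  by rewrite /delta_fun (negbTE ji) ComplexField.Normc.normc0 expr0n.
by rewrite /delta_fun eqxx ComplexField.Normc.normc1 expr1n adde0.
Qed.

Lemma l2_delta i : l2_pred (delta_fun i).
Proof. by rewrite /l2_pred sqsum_delta ltry. Qed.

Definition delta (i : I) : l2 R I := L2 (l2_delta i).

Lemma rnorm_delta i : rnorm (delta i) = 1.
Proof.
apply/eqP; rewrite -(@eqrXn2 _ 2) ?rnorm_ge0 // expr1n; apply/eqP/EFin_inj.
by rewrite rnorm_sqsum sqsum_delta.
Qed.

(** The sum of squares is a supremum of finite partial sums, and the tail beyond a
    nearly optimal finite set is what that set leaves out of the total. *)
Lemma delta_dense (f : l2 R I) (e : R) : 0 < e ->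
  exists s : seq I, rnorm (f - \sum_(i <- s) f i *: delta i) < e.
Proof.
move=> e0; have e20 : 0 < e ^+ 2 by rewrite exprn_gt0.
pose a i : \bar R := (normc (f i) ^+ 2)%:E.
have a0 i : (0 <= a i)%E by rewrite lee_fin sqr_ge0.
have fin : sqsum f \is a fin_num by rewrite -rnorm_sqsum.
have [_ [X [finX _] <-]] := ub_ereal_sup_adherent e20 fin.
rewrite -[ereal_sup _]/(sqsum f) -/a => Xe.
have [t Xt] := (finite_seqP X).1 finX; pose u := undup t.
have Xu : X = [set` u].
  by rewrite Xt; apply/seteqP; split=> i /=; rewrite mem_undup.
exists u; pose r := f - \sum_(i <- u) f i *: delta i.
have rE i : r i = if i \in u then 0 else f i.
  have -> : r i = f i - \sum_(j <- u) f j * (i == j)%:R.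
    by rewrite -(l2_sumE u (fun j => f j *: delta j)).
  case: ifPn => iu; last first.
    rewrite big_seq big1 ?subr0 // => j ju.
    by case: eqP => [ij|_]; [rewrite ij ju in iu|rewrite mulr0].
  rewrite (bigD1_seq i) ?undup_uniq //= eqxx mulr1 big1 ?addr0 ?subrr // => j.
  by rewrite eq_sym => /negbTE ->; rewrite mulr0.
rewrite -/r -(@ltr_pXn2r _ 2) ?nnegrE ?rnorm_ge0 ?(ltW e0) // -lte_fin.
rewrite rnorm_sqsum.
have sE : sqsum f = (\sum_(i \in X) a i + \esum_(i in ~` X) a i)%E.
  rewrite -[sqsum f]/(esum [set: I] a) (esumID X) => [|i _]; last exact: a0.
  by rewrite !setTI esum_fset // => i _; exact: a0.
have rX : (sqsum r <= \esum_(i in ~` X) a i)%E.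
  rewrite [leRHS]esum_mkcond; apply: le_esum => i _; rewrite rE Xu.
  case: ifPn => iu; first by rewrite ComplexField.Normc.normc0 expr0n; case: ifP.
  by rewrite mem_set //=; apply/negP.
apply: le_lt_trans rX _; move: Xe; rewrite -rnorm_sqsum in sE *.
have [c cE] : exists c : R, (\sum_(i \in X) a i)%E = c%:E.
  rewrite Xu -fsbig_seq ?undup_uniq //.
  by exists (\sum_(i <- u) normc (f i) ^+ 2); rewrite sumEFin.
move: sE; rewrite cE; case: (\esum_(i in ~` X) a i)%E => [d| |] //.
rewrite -EFinD => -[->]; rewrite -EFinB !lte_fin; lra.
Qed.

End delta.

(** * The averaging property implies simplicity *)

Section powers_averaging.
Variables (R : realType) (G : groupType).
Local Notation L := (@lreg R G).
Local Notation d1 := (delta R (1%g : G)).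
Implicit Types (S T : bop (l2 R G)) (f : l2 R G) (g h : G).

(** The same conjugators must serve the whole finite set [s]: this is what allows
    a finite combination of group elements to be averaged in one step. *)
Definition powers_averaging : Prop :=
  forall (s : seq G) (e : R), 1%g \notin s -> 0 < e ->
  exists n (h : 'I_n.+1 -> G), forall x, x \in s ->
    rnorm (\sum_i L (h i * x * (h i)^-1)%g) <= e * n.+1%:R.

Lemma lregM g h : L g * L h = L (g * h)%g.
Proof.
apply/val_inj/funext => f; apply/val_inj/funext => k.
by rewrite /= /ltrans invgM mulgA.
Qed.

Lemma lreg1 : L 1%g = 1.
Proof.
apply/val_inj/funext => f; apply/val_inj/funext => k.
by rewrite /= /ltrans invg1 mul1g.
Qed.

Lemma lreg_delta g h : L g (delta R h) = delta R (g * h)%g.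
Proof.
apply/val_inj/funext => k; rewrite /= /ltrans /delta_fun.
by congr ((nat_of_bool _)%:R); apply/eqP/eqP => [<-|->]; rewrite ?mulKg ?mulVKg.
Qed.

Lemma rnorm_lreg g f : rnorm (L g f) = rnorm f.
Proof. by rewrite /rnorm /Num.norm /= /l2norm /= sqsum_ltrans. Qed.

Lemma lreg_reduced g : reduced_Cstar_algebra R G (L g).
Proof.
apply: subset_closure; exists [:: (1, g)].
by rewrite big_seq1 scale1r.
Qed.

(** The canonical trace, as a matrix coefficient. *)
Definition tau T : R[i] := T (d1) 1%g.

Lemma normc_tau T : normc (tau T) <= rnorm T.
Proof.
apply: le_trans (normc_le_rnorm _ _) _.
by rewrite -[leRHS]mulr1 -(rnorm_delta R (1%g : G)); exact: bop_bound.
Qed.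

Lemma tau_lreg g : tau (L g) = (g == 1%g)%:R.
Proof. by rewrite /tau lreg_delta mulg1 eq_sym. Qed.

(** Operators of the reduced algebra commute with right translations; read on
    matrix coefficients, this is an identity that holds for each [lreg g] and
    passes to norm limits. *)
Lemma reduced_coefE T f g h : reduced_Cstar_algebra R G T ->
  T (delta R h) g = T (d1) (g * h^-1)%g.
Proof.
move=> /closure_rnormP AT; apply/eqP; rewrite -subr_eq0; apply/eqP.
apply: ComplexField.Normc.eq0_normc; apply/eqP; rewrite eq_le normc_ge0 andbT.
apply/ler_addgt0Pl => e e0; rewrite addr0.
have [S [s SE] TS] := AT (e / 2) (divr_gt0 e0 (ltr0Sn R 1)).
have HS : S (delta R h) g = S (d1) (g * h^-1)%g.
  rewrite SE !bop_sumE !l2_sumE; apply: eq_bigr => -[c k] _ /=.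
  rewrite /delta_fun /ltrans; congr (c *: (nat_of_bool _)%:R).
  by rewrite mulgA -/(_ / _)%g divg_eq1.
have -> : T (delta R h) g - T (d1) (g * h^-1)%g =
    (T - S) (delta R h) g - (T - S) (d1) (g * h^-1)%g.
  have E k l : (T - S) (delta R k) l = T (delta R k) l - S (delta R k) l by [].
  rewrite !E HS; ring.
have B k l : normc ((T - S) (delta R k) l) <= e / 2.
  apply: le_trans (normc_le_rnorm _ _) _; apply: le_trans (bop_bound _ _) _.
  by rewrite rnorm_delta mulr1 ltW.
rewrite (splitr e); apply: le_trans (lerD (B h g) (B 1%g (g * h^-1)%g)).
by rewrite -lecR rmorphD; exact: (@ler_normB _ R[i]).
Qed.

(** The vector delta_1 is separating: [reduced_coefE] makes T vanish on every
    delta_h, and these span a dense subspace. *)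
Lemma reduced_eq0 T : reduced_Cstar_algebra R G T ->
  T (d1) = 0 -> T = 0.
Proof.
move=> AT T1; apply/val_inj/funext => f; change (T f = 0).
apply: rnorm_eq0; apply/eqP.
rewrite eq_le rnorm_ge0 andbT; apply/ler_addgt0Pl => e e0; rewrite addr0.
have M0 : 0 < rnorm T + 1 by rewrite ltr_wpDl ?rnorm_ge0.
have [s fs] := delta_dense f (divr_gt0 e0 M0).
have Td h : T (delta R h) = 0.
  by apply/val_inj/funext => g; rewrite [LHS]reduced_coefE // T1.
have Ts : T (\sum_(i <- s) f i *: delta R i) = 0.
  elim: s {fs} => [|i s IH]; first by rewrite big_nil bop0.
  by rewrite big_cons (bopP T).1 IH Td scaler0 addr0.
have -> : T f = T (f - \sum_(i <- s) f i *: delta R i).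
  by rewrite -scaleN1r addrC (bopP T).1 Ts scaler0 add0r.
apply: le_trans (bop_bound _ _) _.
apply: (@le_trans _ _ ((rnorm T + 1) * (e / (rnorm T + 1)))); last first.
  by rewrite mulrC divfK // gt_eqF.
by apply: ler_pM; rewrite ?rnorm_ge0 ?lerDl // ltW.
Qed.

Section average.
Variables (n : nat) (h : 'I_n.+1 -> G).

Definition conj_avg T : bop (l2 R G) :=
  n.+1%:R^-1 *: \sum_i L (h i) * T * L (h i)^-1%g.

Lemma conj_avgD S T : conj_avg (S + T) = conj_avg S + conj_avg T.
Proof.
rewrite /conj_avg -scalerDr -big_split; congr (_ *: _).
by apply: eq_bigr => i _; rewrite mulrDr mulrDl.
Qed.

Lemma conj_avgZ c T : conj_avg (c *: T) = c *: conj_avg T.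
Proof.
rewrite /conj_avg [RHS]scalerA mulrC -scalerA [c *: \sum_i _]scaler_sumr; congr (_ *: _).
by apply: eq_bigr => i _; rewrite bop_scalerAr bop_scalerAl.
Qed.

Lemma normc_invn : normc (n.+1%:R^-1 : R[i]) = n.+1%:R^-1.
Proof.
rewrite ComplexField.Normc.normcV; congr (_^-1).
have -> : (n.+1%:R : R[i]) = (n.+1%:R)%:C by rewrite rmorph_nat.
by rewrite /= expr0n addr0 sqrtr_sqr ger0_norm.
Qed.

Lemma rnorm_conj_avg T : rnorm (conj_avg T) <= rnorm T.
Proof.
rewrite rnormZ normc_invn ler_pdivrMl ?ltr0n //.
apply: le_trans (rnorm_sum _ _) _.
rewrite [leRHS](_ : _ = \sum_(i < n.+1) rnorm T); last first.
  by rewrite sumr_const card_ord mulr_natl.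
apply: ler_sum => i _; apply: rnorm_bop_le => [|f]; first exact: rnorm_ge0.
rewrite (rnorm_lreg (h i) (T (L (h i)^-1%g f))).
by apply: le_trans (bop_bound _ _) _; rewrite rnorm_lreg.
Qed.

Lemma conj_avg_lreg g :
  conj_avg (L g) = n.+1%:R^-1 *: \sum_i L (h i * g * (h i)^-1)%g.
Proof.
by rewrite /conj_avg; congr (_ *: _); apply: eq_bigr => i _; rewrite !lregM.
Qed.

(** Working with the linear map [avg_defect] reduces the convergence of averages
    to the generators [lreg g] and to a uniform bound. *)
Definition avg_defect T := conj_avg T - tau T *: (1 : bop (l2 R G)).

Lemma avg_defectD S T : avg_defect (S + T) = avg_defect S + avg_defect T.
Proof.
rewrite /avg_defect conj_avgD (_ : tau (S + T) = tau S + tau T) //.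
by rewrite scalerDl opprD addrACA.
Qed.

Lemma avg_defectZ c T : avg_defect (c *: T) = c *: avg_defect T.
Proof.
rewrite /avg_defect conj_avgZ (_ : tau (c *: T) = c * tau T) //.
by rewrite scalerBr -scalerA.
Qed.

Lemma rnorm_bop1 : rnorm (1 : bop (l2 R G)) <= 1.
Proof. by apply: rnorm_bop_le => // f; rewrite mul1r. Qed.

Lemma rnorm_avg_defect T : rnorm (avg_defect T) <= 2 * rnorm T.
Proof.
apply: le_trans (rnormB_le _ _) _; rewrite mulr_natl mulr2n.
apply: lerD; first exact: rnorm_conj_avg.
rewrite rnormZ -[leRHS]mulr1.
by apply: ler_pM; rewrite ?rnorm_ge0 ?normc_ge0 ?normc_tau ?rnorm_bop1.
Qed.

Lemma avg_defect1 : avg_defect 1 = 0.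
Proof.
rewrite -lreg1 /avg_defect tau_lreg eqxx conj_avg_lreg.
under eq_bigr do rewrite mulg1 mulgV.
rewrite sumr_const card_ord -[L _ *+ _]scaler_nat scalerA mulVf ?pnatr_eq0 //.
by rewrite lreg1 subrr.
Qed.

End average.

Lemma avg_defect_small T (e : R) : powers_averaging ->
  reduced_Cstar_algebra R G T -> 0 < e ->
  exists n (h : 'I_n.+1 -> G), rnorm (avg_defect h T) <= e.
Proof.
move=> P /closure_rnormP AT e0.
have [S [s SE] TS] := AT (e / 4) (divr_gt0 e0 (ltr0Sn R 3)).
(* Adding 1 keeps the denominator of the tolerance positive. *)
pose C : R := \sum_(p <- s) normc p.1 + 1.
have C0 : 0 < C.
  by rewrite ltr_wpDl // sumr_ge0 // => p _; exact: normc_ge0.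
have eC : 0 < e / 2 / C by rewrite !divr_gt0.
have [|n [h hs]] := P [seq p.2 | p <- s & p.2 != 1%g] (e / 2 / C) _ eC.
  by apply/mapP => -[p]; rewrite mem_filter => /andP[/eqP p1 _] /esym/p1.
exists n, h.
have -> : T = (T - S) + S by rewrite subrK.
rewrite avg_defectD; apply: le_trans (rnormD _ _) _; rewrite [leRHS]splitr.
apply: lerD.
  apply: le_trans (rnorm_avg_defect _ _) _.
  by lra.
have SsE : avg_defect h S = \sum_(p <- s) p.1 *: avg_defect h (L p.2).
  rewrite SE; elim: (s) => [|p r IH].
    by rewrite !big_nil -(scale0r 0) avg_defectZ !scale0r.
  by rewrite !big_cons avg_defectD avg_defectZ IH.
rewrite SsE; apply: le_trans (rnorm_sum _ _) _.
apply: (@le_trans _ _ (\sum_(p <- s) normc p.1 * (e / 2 / C))); last first.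
  rewrite -mulr_suml mulrC -[leRHS](@divfK _ C) ?gt_eqF // ler_pM2l //.
  by rewrite lerDl.
rewrite big_seq [leRHS]big_seq; apply: ler_sum => p ps.
rewrite rnormZ ler_wpM2l ?normc_ge0 //.
have [->|p1] := eqVneq p.2 1%g.
  by rewrite lreg1 avg_defect1 rnorm0 ltW.
rewrite /avg_defect tau_lreg (negbTE p1) scale0r subr0 conj_avg_lreg.
rewrite rnormZ normc_invn ler_pdivrMl ?ltr0n // mulrC.
by apply: hs; apply/mapP; exists p; rewrite // mem_filter p1.
Qed.

(** Since tau is kept fixed while the error tends to 0, closedness of the ideal
    yields the scalar tau U itself, with no need to invert a perturbation of it. *)
Theorem powers_averaging_simple : powers_averaging -> Cstar_simple R G.
Proof.
move=> P I [IA I0 ID IZ IMl IMr Icl].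
have [[T [IT T0]]|I0'] := pselect (exists T, I T /\ T <> 0); last first.
  left; apply/seteqP; split=> [T IT|_ -> //].
  by apply: contrapT => T0; apply: I0'; exists T.
right; apply/seteqP; split=> // S AS.
suff I1 : I 1 by rewrite -[S]mulr1; exact: IMl.
have [g Tg] : exists g, T (d1) g != 0.
  apply: contrapT => H; apply: T0; apply: reduced_eq0; first exact: IA.
  apply/val_inj/funext => g; apply/eqP; apply: contrapT => /negP Tg.
  by apply: H; exists g.
pose U := L (g^-1)%g * T.
have IU : I U by apply: IMl => //; exact: lreg_reduced.
have tU : tau U != 0 by rewrite /tau /U /= /ltrans invgK mulg1.
suff : I (tau U *: (1 : bop (l2 R G))).
  by move/(IZ (tau U)^-1); rewrite scalerA mulVf // scale1r.
rewrite ((closure_id I).1 Icl) //; apply/closure_rnormP => e e0.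
have [n [h hU]] := avg_defect_small P (IA _ IU) (divr_gt0 e0 (ltr0Sn R 1)).
exists (conj_avg h U).
  apply: IZ; elim/big_ind: _ => // i _.
  by apply: IMr; [exact: lreg_reduced|apply: IMl => //; exact: lreg_reduced].
rewrite -rnormN opprB; apply: le_lt_trans hU _.
by rewrite ltr_pdivrMr // ltr_pMr // ltr1n.
Qed.

End powers_averaging.

(** * Sequences and their prefixes *)

Section cantor_words.
Implicit Types (x y : cantor_space) (w v : seq bool).

Definition shiftw (n : nat) x : cantor_space := fun k => x (k + n)%N.

Lemma catw_shiftw n x : catw (mkseq x n) (shiftw n x) = x.
Proof.
apply/funext => k; rewrite /catw size_mkseq /shiftw.
by case: ltnP => kn; [rewrite nth_mkseq|rewrite subnK].
Qed.

Lemma catw_lt w x k : (k < size w)%N -> catw w x k = nth false w k.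
Proof. by rewrite /catw => ->. Qed.

Lemma catw_addl w x k : catw w x (size w + k) = x k.
Proof. by rewrite /catw ltnNge leq_addr addKn. Qed.

Lemma mkseq_catw w x : mkseq (catw w x) (size w) = w.
Proof. by apply/cylinderP; exists x. Qed.

Lemma shiftw_catw w x : shiftw (size w) (catw w x) = x.
Proof. by apply/funext => k; rewrite /shiftw addnC catw_addl. Qed.

Lemma eq_mkseq_lt n x y k : mkseq x n = mkseq y n -> (k < n)%N -> x k = y k.
Proof. by move=> e kn; rewrite -(nth_mkseq false x kn) e nth_mkseq. Qed.

Lemma eq_mkseq n x y : (forall k, (k < n)%N -> x k = y k) ->
  mkseq x n = mkseq y n.
Proof.
by move=> e; apply/eq_in_map => k; rewrite mem_iota add0n => /andP[_]; exact: e.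
Qed.

Lemma eq_mkseq_le m n x y : (m <= n)%N -> mkseq x n = mkseq y n ->
  mkseq x m = mkseq y m.
Proof.
by move=> mn e; apply: eq_mkseq => k km; apply: eq_mkseq_lt e (leq_trans km mn).
Qed.

Lemma continuous_cantor (f : cantor_space -> cantor_space) :
  (forall k, exists n, forall x y, mkseq x n = mkseq y n -> f x k = f y k) ->
  continuous f.
Proof.
move=> fP x; apply/pointwise_cvgP => k.
have [n fn] := fP k.
have near_prefix : \forall y \near x, mkseq x n = mkseq y n.
  elim: n {fn} => [|n IH]; first exact: (@nearW _ (nbhs x)).
  have xn : \forall y \near x, y n = x n.
    apply: (@proj_continuous nat (fun=> bool) n x [set x n]).
    exact: discrete_set1.
  near=> y; rewrite !mkseqS; congr rcons; first by near: y.
  by apply/esym; near: y.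
move=> A /nbhs_singleton Afx; apply: filterS near_prefix => y xy.
by rewrite /= -(fn _ _ xy).
Unshelve. all: by end_near. Qed.

End cantor_words.

(** * Elements of V as prefix replacements at a uniform depth *)

Section prefix_maps.
Implicit Types (f : cantor_space -> cantor_space) (x y : cantor_space).

(** Prefixes of one fixed length are enough, because a finite cylinder partition
    is refined by all words of a large length. This form needs no bookkeeping of
    partitions. *)
Definition prefix_map n f := forall w : seq bool, size w = n ->
  exists z, forall y, f (catw w y) = catw z y.

Lemma prefix_map_digit n f k x y : prefix_map n f ->
  mkseq x (n + k.+1) = mkseq y (n + k.+1) -> f x k = f y k.
Proof.
move=> /(_ (mkseq x n) (size_mkseq _ _)) [z fz] xy.
have xyn : mkseq x n = mkseq y n := eq_mkseq_le (leq_addr _ _) xy.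
rewrite -[x in LHS](catw_shiftw n) -[y in RHS](catw_shiftw n) -xyn !fz.
rewrite /catw; case: ltnP => // kz; rewrite /shiftw.
apply: eq_mkseq_lt xy _.
by rewrite addnC ltn_add2l ltnS leq_subr.
Qed.

Lemma prefix_map_continuous n f : prefix_map n f -> continuous f.
Proof.
move=> fP; apply: continuous_cantor => k; exists (n + k.+1)%N => x y.
exact: prefix_map_digit.
Qed.

(** The words of length [n] form the source partition; the target cylinders are
    the preimages of the source ones by the involution [f], so they form a
    partition as well. *)
Lemma prefix_involution_in_thompsonV n f : involutive f -> prefix_map n f ->
  in_thompsonV f.
Proof.
move=> fK fP; have cf := prefix_map_continuous fP.
split; first by exists f; split.
have /choice[z fz] (t : n.-tuple bool) := fP t (size_tuple t).
pose e (i : 'I_#|{: n.-tuple bool}|) : n.-tuple bool := enum_val i.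
exists #|{: n.-tuple bool}|, (fun i => e i), (fun i => z (e i)).
have cov x : exists i : _, cylinder (e i) x.
  exists (enum_rank [tuple of mkseq x n]).
  by rewrite /e enum_rankK /cylinder /= size_mkseq.
have disj x i j :
    cylinder (e i) x -> cylinder (e j) x -> i = j.
  rewrite /cylinder /= !size_tuple => xi xj.
  by apply/enum_val_inj/val_inj; rewrite /= -xi -xj.
have zw i x : cylinder (z (e i)) x <-> cylinder (e i) (f x).
  split=> /cylinderP[y xy]; apply/cylinderP; exists y.
    by rewrite xy -fz fK.
  by rewrite -fz -xy fK.
split=> [||i x]; last exact: fz.
- by apply/cylinder_partitionP; split.
- apply/cylinder_partitionP; split=> [x|x i j /zw xi /zw xj].
    by have [i fi] := cov (f x); exists i; apply/zw.
  exact: disj xi xj.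
Qed.

Lemma thompsonV_prefix_map (g : thompsonV) : exists n, prefix_map n g.
Proof.
have [_ [m [w [z [/cylinder_partitionP[cov _] _ gwz]]]]] := thompsonVP g.
exists (\max_i size (w i)) => v vn.
have [i wi] := cov (catw v point).
have le_wv : (size (w i) <= size v)%N by rewrite vn leq_bigmax.
have /prefixP[s vE] : prefix (w i) v.
  have vv : cylinder v (catw v point) by apply/cylinderP; exists point.
  case/orP: (cylinder_common vv wi) => // /prefixP[s wE].
  move: le_wv; rewrite wE size_cat -[leqRHS]addn0 leq_add2l leqn0 => /nilP ->.
  by rewrite cats0 prefix_refl.
by exists (z i ++ s) => y; rewrite vE !catw_cat gwz.
Qed.

(** Continuity of [g] at [p], with the explicit modulus of a prefix map. *)
Lemma thompsonV_separation (g : thompsonV) p q : g p <> q ->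
  exists m, forall x y,
    mkseq x m = mkseq p m -> mkseq y m = mkseq q m -> g x <> y.
Proof.
move=> gpq; have [k gk] : exists k, g p k <> q k.
  by apply: contrapT => H; apply/gpq/funext => k; apply: contrapT => ?; apply: H; exists k.
have [n gn] := thompsonV_prefix_map g; exists (n + k.+1)%N => x y xp yq gxy.
apply: gk; rewrite -(prefix_map_digit gn xp) gxy.
by apply: eq_mkseq_lt yq _; rewrite addnS ltnS leq_addl.
Qed.

End prefix_maps.

(** * Points and cylinders in general position *)

Section thompsonV_points.
Implicit Types (g : thompsonV) (s : seq thompsonV).

Lemma thompsonV_mulE g h x : (g * h)%g x = g (h x). Proof. by []. Qed.

Lemma thompsonV_invgK g : cancel g (g^-1)%g.
Proof. exact: thompsonV_funK. Qed.

Lemma thompsonV_invgKV g : cancel (g^-1)%g g.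
Proof. exact: thompsonV_invK. Qed.

(** The points moved by [g] contain a whole cylinder, inside which a diagonal
    sequence avoids the list [zs]. *)
Lemma moved_point g (zs : seq cantor_space) : g != 1%g ->
  exists q : cantor_space, g q <> q /\ q \notin zs.
Proof.
move=> g1; have [p gp] : exists p, g p <> p.
  apply: contrapT => H; move/eqP: g1; apply; apply/val_inj/funext => x.
  by apply: contrapT => ?; apply: H; exists x.
have [m gm] := thompsonV_separation gp.
pose q : cantor_space := fun k =>
  if (k < m)%N then p k else ~~ nth point zs (k - m) k.
have qp : mkseq q m = mkseq p m by apply: eq_mkseq => k km; rewrite /q km.
exists q; split; first exact: gm.
apply/negP => /(nthP point)[i _ /(congr1 (fun x : cantor_space => x (i + m)%N))].
by rewrite /q ltnNge leq_addl addnK /=; case: nth.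
Qed.

(** Points are chosen one element at a time; a new point has to be moved by its
    element and to avoid finitely many images and preimages of the former ones. *)
Lemma separated_points s : 1%g \notin s ->
  exists q : thompsonV -> cantor_space,
    forall g h, g \in s -> h \in s -> g (q h) <> q g.
Proof.
elim: s => [|g s IH]; first by exists (fun=> point).
rewrite in_cons eq_sym => /norP[g1 /IH[q qP]].
have [p [gp]] := moved_point ([seq g (q h) | h <- s] ++
  [seq (h^-1 : thompsonV)%g (q h) | h : thompsonV <- s]) g1.
rewrite mem_cat => /norP[pg ph].
exists (fun h => if h == g then p else q h) => a b.
rewrite !in_cons; have [->|ag] := eqVneq a g; have [->|bg] := eqVneq b g => //=.
- move=> _ bs gqb; move/negP: pg; apply.
  by apply/mapP; exists b.
- move=> as_ _ ap; move/negP: ph; apply; apply/mapP; exists a => //.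
  by rewrite -ap thompsonV_invgK.
- exact: qP.
Qed.

Lemma separated_prefixes s : 1%g \notin s ->
  exists (q : thompsonV -> cantor_space) m, forall g h, g \in s -> h \in s ->
    forall x y, mkseq x m = mkseq (q h) m -> mkseq y m = mkseq (q g) m ->
    g x <> y.
Proof.
move=> /separated_points[q qP]; exists q.
have /choice[d dP] (u : thompsonV * thompsonV) : exists m,
    u.1 \in s -> u.2 \in s -> forall x y, mkseq x m = mkseq (q u.2) m ->
    mkseq y m = mkseq (q u.1) m -> u.1 x <> y.
  have [us|] := pselect (u.1 \in s /\ u.2 \in s); last first.
    by move=> us; exists 0%N => u1 u2; case: us.
  by have [m mP] := thompsonV_separation (qP _ _ us.1 us.2); exists m.
exists (\max_(u <- [seq (g, h) | g <- s, h <- s]) d u) => g h gs hs x y xh yg.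
have le_d : (d (g, h) <= \max_(u <- [seq (g, h) | g <- s, h <- s]) d u)%N.
  by apply: leq_bigmax_seq => //; apply/allpairsP; exists (g, h).
exact: dP (g, h) gs hs x y (eq_mkseq_le le_d xh) (eq_mkseq_le le_d yg).
Qed.

End thompsonV_points.

(** * Ping-pong players supported in given cylinders *)

Section players.
Implicit Types (x y : cantor_space) (v w : seq bool).

(** The involution that exchanges [x] and [v x] for [x] outside of [cylinder v],
    and fixes [v v y]. It sends the complement of [cylinder v] into
    [cylinder v]. *)
Definition slide v x : cantor_space :=
  if mkseq x (size v) == v then
    let y := shiftw (size v) x in if mkseq y (size v) == v then x else y
  else catw v x.

Lemma slide_out v x : ~ cylinder v x -> slide v x = catw v x.
Proof. by rewrite /slide => /eqP/negbTE ->. Qed.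

Lemma slide_in v x : ~ cylinder v x -> slide v (catw v x) = x.
Proof.
by rewrite /slide mkseq_catw eqxx shiftw_catw => /eqP/negbTE /= ->.
Qed.

Lemma slide_fix v x : slide v (catw v (catw v x)) = catw v (catw v x).
Proof. by rewrite /slide mkseq_catw eqxx shiftw_catw mkseq_catw eqxx. Qed.

Lemma slideK v : involutive (slide v).
Proof.
move=> x; have [/cylinderP[y ->]|vx] := pselect (cylinder v x); last first.
  by rewrite [slide v x]slide_out // slide_in.
have [/cylinderP[z ->]|vy] := pselect (cylinder v y); first by rewrite !slide_fix.
by rewrite slide_in // slide_out.
Qed.

Lemma slide_prefix_map v : prefix_map (size v + size v) (slide v).
Proof.
move=> w sw.
have [a [b [-> sa sb]]] : exists a b, [/\ w = a ++ b, size a = size v & size b = size v].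
  exists (take (size v) w), (drop (size v) w).
  by rewrite cat_take_drop size_drop sw addKn size_takel // sw leq_addl.
have cylE c y : size c = size v -> cylinder v (catw c y) <-> c = v.
  by move=> sc; rewrite /cylinder /= -sc mkseq_catw.
have [->|/eqP av] := eqVneq a v; last first.
  exists (v ++ a ++ b) => y; rewrite slide_out ?catw_cat //.
  by move/(cylE _ _ sa).
have [->|/eqP bv] := eqVneq b v.
  by exists (v ++ v) => y; rewrite catw_cat slide_fix.
exists b => y; rewrite catw_cat slide_in //.
by move/(cylE _ _ sb).
Qed.

Variables (m : nat) (P : seq (seq bool)).

Definition local_slide v x : cantor_space :=
  if mkseq x m \in P then catw (mkseq x m) (slide v (shiftw m x)) else x.

Lemma local_slide_out v x : mkseq x m \notin P -> local_slide v x = x.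
Proof. by rewrite /local_slide => /negbTE ->. Qed.

Lemma local_slide_in v w x : size w = m -> w \in P ->
  local_slide v (catw w x) = catw w (slide v x).
Proof. by rewrite /local_slide => <- wP; rewrite mkseq_catw wP shiftw_catw. Qed.

Lemma local_slideK v : involutive (local_slide v).
Proof.
move=> x; have [xP|xP] := boolP (mkseq x m \in P); last first.
  by rewrite !local_slide_out.
rewrite -(catw_shiftw m x) !local_slide_in ?size_mkseq //.
by rewrite slideK.
Qed.

Lemma local_slide_prefix_map v :
  prefix_map (m + (size v + size v)) (local_slide v).
Proof.
move=> w sw; have [a [b [-> sa sb]]] : exists a b,
    [/\ w = a ++ b, size a = m & size b = (size v + size v)%N].
  exists (take m w), (drop m w).
  by rewrite cat_take_drop size_drop sw addKn size_takel // sw leq_addr.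
have [aP|aP] := boolP (a \in P); last first.
  by exists (a ++ b) => y; rewrite local_slide_out // catw_cat -sa mkseq_catw.
have [z bz] := slide_prefix_map sb.
by exists (a ++ z) => y; rewrite !catw_cat local_slide_in // bz.
Qed.

Definition player v : thompsonV := ThompsonV (asboolT
  (prefix_involution_in_thompsonV (@local_slideK v) (@local_slide_prefix_map v))).

Lemma player_out v x : mkseq x m \notin P -> player v x = x.
Proof. exact: local_slide_out. Qed.

Lemma player_in v w x : size w = m -> w \in P ->
  player v (catw w x) = catw w (slide v x).
Proof. exact: local_slide_in. Qed.

End players.

(** The words 1...10, an infinite family with pairwise disjoint cylinders. *)
Definition unary (i : nat) : seq bool := rcons (nseq i true) false.

Lemma unary_cylinder i x : cylinder (unary i) x ->
  x i = false /\ forall k, (k < i)%N -> x k = true.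
Proof.
have si : size (unary i) = i.+1 by rewrite size_rcons size_nseq.
move=> /cylinderP[y ->]; split=> [|k ki].
  by rewrite catw_lt ?si // nth_rcons size_nseq ltnn eqxx.
by rewrite catw_lt ?si ?ltnS 1?ltnW // nth_rcons size_nseq ki nth_nseq ki.
Qed.

Lemma unary_disjoint i j x :
  cylinder (unary i) x -> cylinder (unary j) x -> i = j.
Proof.
move=> /unary_cylinder[xi ix] /unary_cylinder[xj jx].
by case: (ltngtP i j) => // [/jx|/ix]; rewrite ?xi ?xj.
Qed.

(** * From ping-pong on a cylinder to ping-pong on the group *)

Section slide_norm.
Variables (R : realType) (n : nat) (w : seq bool) (a : 'I_n -> thompsonV).
Hypothesis aw : forall i x, a i (catw w x) = catw w (slide (unary i) x).

(** The group generated by the [a i] preserves [cylinder w], but the orbit of a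
    fixed base point under an arbitrary [g] may leave it. The base point
    [get (landing g)] therefore depends on [g], through a set that is invariant
    under left multiplication by the [a i] ([landing_mul]); so [track] is
    equivariant. *)
Definition landing (g : thompsonV) : set cantor_space := [set x | cylinder w (g x)].

Definition track (g : thompsonV) : cantor_space :=
  shiftw (size w) (g (get (landing g))).

Lemma trackE (g : thompsonV) : g (get (landing g)) = catw w (track g).
Proof.
have /(@getPex _) : exists x, landing g x.
  exists ((g^-1 : thompsonV)%g (catw w point)).
  by rewrite /landing /= thompsonV_invgKV; apply/cylinderP; exists point.
by move=> /cylinderP[y e]; rewrite /track e shiftw_catw.
Qed.

Lemma landing_mul i (g : thompsonV) : landing (a i * g)%g = landing g.
Proof.
apply/seteqP; split=> x /cylinderP[y]; rewrite ?thompsonV_mulE => e.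
  apply/cylinderP; exists (slide (unary i) y).
  apply: (can_inj (thompsonV_invgK (a i))).
  by rewrite e aw slideK.
by apply/cylinderP; exists (slide (unary i) y); rewrite thompsonV_mulE e aw.
Qed.

Lemma track_mul i (g : thompsonV) : track (a i * g)%g = slide (unary i) (track g).
Proof.
apply: (@catwI w); rewrite -trackE landing_mul thompsonV_mulE.
by rewrite trackE aw.
Qed.

Lemma slide_rnorm (f : l2 R thompsonV) :
  rnorm (\sum_i lreg R (a i) f) <= 2 * Num.sqrt n%:R * rnorm f.
Proof.
have Dtriv (i j : 'I_n) g : cylinder (unary i) (track g) ->
    cylinder (unary j) (track g) -> i = j.
  by move=> gi gj; apply/val_inj; exact: unary_disjoint gi gj.
have Dmap (i : 'I_n) g : ~ cylinder (unary i) (track g) ->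
    cylinder (unary i) (track (a i * g)%g).
  by move=> gi; rewrite track_mul slide_out //; apply/cylinderP; exists (track g).
have := @pingpong_rnorm R _ _ a (fun i => [set g | cylinder (unary i) (track g)])
  Dtriv Dmap f.
by rewrite card_ord.
Qed.

End slide_norm.

(** * The averaging property of V *)

Lemma thompsonV_powers_averaging (R : realType) : powers_averaging R thompsonV.
Proof.
move=> s e s1 e0.
have [q [m sep]] := separated_prefixes s1.
pose P := [seq mkseq (q g) m | g <- s].
(* 2 sqrt N <= e N as soon as N >= 4 / e^2. *)
pose n := Num.truncn (4 / e ^+ 2).
exists n, (fun i => player m P (unary i)) => g gs.
apply: rnorm_bop_le => [|f]; first by rewrite mulr_ge0 // ltW.
pose w := mkseq (q g) m.
have sw : size w = m by rewrite size_mkseq.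
have wP : w \in P by apply/mapP; exists g.
pose a (i : 'I_n.+1) : thompsonV :=
  (player m P (unary i) * (g * (player m P (unary i))^-1 * g^-1))%g.
have aw i x : a i (catw w x) = catw w (slide (unary i) x).
  rewrite /a !thompsonV_mulE.
  (* [b] lies outside of the support of the player, which therefore fixes it. *)
  set b := (g^-1 : thompsonV)%g (catw w x).
  have gb : g b = catw w x by rewrite /b thompsonV_invgKV.
  have bP : mkseq b m \notin P.
    apply/mapP => -[h hs bh]; apply: (sep g h gs hs b (catw w x)) => //.
    by rewrite -{1}sw mkseq_catw.
  have -> : ((player m P (unary i))^-1 : thompsonV)%g b = b.
    by rewrite -{1}(player_out (unary i) bP) thompsonV_invgK.
  by rewrite gb player_in.
rewrite [X in rnorm X](_ : _ = \sum_i lreg R (a i) (lreg R g f)); last first.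
  rewrite bop_sumE; apply: eq_bigr => i _.
  rewrite -[RHS]/((lreg R (a i) * lreg R g) f) lregM; congr (lreg R _ f).
  by rewrite /a !mulgA mulgVK.
apply: le_trans (slide_rnorm aw _) _; rewrite rnorm_lreg.
rewrite ler_wpM2r ?rnorm_ge0 //.
have nE : 4 / e ^+ 2 <= n.+1%:R by rewrite ltW // truncnS_gt.
have s0 : 0 < Num.sqrt (n.+1%:R : R) by rewrite sqrtr_gt0.
rewrite -[in leRHS](@sqr_sqrtr _ n.+1%:R) // expr2 mulrA ler_pM2r //.
rewrite -(@ler_pXn2r _ 2) ?nnegrE ?mulr_ge0 ?(ltW e0) ?(ltW s0) //.
rewrite exprMn sqr_sqrtr // mulrC -ler_pdivrMr ?exprn_gt0 //.
by apply: le_trans nE; rewrite -natrX.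
Qed.

Theorem theorem1p5 (R : realType) : Cstar_simple R thompsonV.
Proof. exact/powers_averaging_simple/thompsonV_powers_averaging. Qed.
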